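(* Let $d\ge1$, $s\in(0,1)$, $p>\frac ds$ and $\Lambda>0$. There exists a constant $c=c(p,d,s,\Lambda)>0$ such that the following holds. Let $\Sigma=\Sigma^d=\partial\Omega$ be the smooth boundary of a compact convex body in $\mathbb{R}^{d+1}$, and assume $\mathcal{W}_{s,p}(\Sigma)\le\Lambda$. Then $$\mathcal{H}^d(\Sigma)\ge c .$$
   Context: For $\Sigma=\partial\Omega\subset\mathbb{R}^{d+1}$ with $\Omega$ bounded and $\Sigma$ smooth, let $n:\Sigma\to\mathbb{S}^d$ be the outward unit normal. The fractional mean curvature is $$H_{\Sigma,s}(x):=c_s\int_\Sigma\frac{\langle x-y,n(y)\rangle}{|x-y|^{d+1+s}}\,d\mathcal{H}^d(y),$$ where $c_s>0$ is a fixed normalizing constant, and the fractional Willmore energy is $\mathcal{W}_{s,p}(\Sigma):=\int_\Sigma|H_{\Sigma,s}(x)|^p\,d\mathcal{H}^d(x)$. $\mathcal{H}^d$ is $d$-dimensional Hausdorff measure. *)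

(* Defs.v *)
From HB Require Import structures.
From mathcomp Require Import all_boot all_order all_algebra.
From mathcomp Require Import all_classical all_reals all_analysis.

Set Implicit Arguments.
Unset Strict Implicit.
Unset Printing Implicit Defensive.

Import Order.TTheory GRing.Theory Num.Theory.
Import numFieldNormedType.Exports.

Local Open Scope classical_set_scope.
Local Open Scope ring_scope.

(* MathComp-Analysis norms 'rV[R]_n by the maximum of the coordinates; it
   induces the usual topology, but every metric quantity below (distance,
   diameter, unit vector) has to be Euclidean. *)
Section euclidean.
Context {R : realType} {n : nat}.
Implicit Types u v : 'rV[R]_n.

Definition edot u v : R := \sum_(i < n) u 0 i * v 0 i.

Definition enorm u : R := Num.sqrt (edot u u).

Definition ediam (A : set 'rV[R]_n) : \bar R :=
  ereal_sup [set (enorm (xy.1 - xy.2))%:E | xy in A `*` A].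

Definition boundary (A : set 'rV[R]_n) : set 'rV[R]_n := closure A `\` A°.

End euclidean.

(* Volume of the unit ball of R^m, pi^(m/2) / Gamma(m/2 + 1), through its
   two-step recursion. *)
Fixpoint unit_ball_volume (R : realType) (m : nat) : R :=
  match m with
  | 0 => 1
  | 1 => 2
  | k.+2 => 2 * pi / k.+2%:R * unit_ball_volume R k
  end.

Section hausdorff_measure.
Context {R : realType} {n : nat}.
Variable m : nat.
Local Open Scope ereal_scope.

Definition hausdorff_gauge (A : set 'rV[R]_n) : \bar R :=
  if A == set0 then 0
  else (unit_ball_volume R m / 2 ^+ m)%:E * ediam A ^+ m.

Definition hausdorff_cover (delta : R) (A : set 'rV[R]_n) :
    set (set 'rV[R]_n)^nat :=
  [set F | (forall k, ediam (F k) <= delta%:E) /\ A `<=` \bigcup_k F k].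

Definition hausdorff_content (delta : R) (A : set 'rV[R]_n) : \bar R :=
  ereal_inf [set \sum_(k <oo) hausdorff_gauge (F k) |
             F in hausdorff_cover delta A].

Definition hausdorff (A : set 'rV[R]_n) : \bar R :=
  ereal_sup [set hausdorff_content delta A | delta in [set r : R | (0 < r)%R]].

Lemma unit_ball_volume_ge0 k : (0 <= unit_ball_volume R k)%R.
Proof.
suff: (0 <= unit_ball_volume R k)%R /\ (0 <= unit_ball_volume R k.+1)%R by case.
elim: k => [|k [IH0 IH1]]; first by split => /=.
split => //; rewrite [unit_ball_volume R k.+2]/=.
by rewrite mulr_ge0// divr_ge0// mulr_ge0// pi_ge0.
Qed.

Lemma hausdorff_gauge_ge0 A : 0 <= hausdorff_gauge A.
Proof.
rewrite /hausdorff_gauge; case: ifPn => // /set0P[x Ax].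
apply: mule_ge0.
  by rewrite lee_fin divr_ge0 ?unit_ball_volume_ge0// exprn_ge0.
apply: expe_ge0; apply: ereal_sup_ubound; exists (x, x) => //=.
by rewrite subrr /enorm /edot big1 ?sqrtr0// => i _; rewrite mxE mul0r.
Qed.

Lemma hausdorff_gauge0 : hausdorff_gauge set0 = 0.
Proof. by rewrite /hausdorff_gauge eqxx. Qed.

Lemma ediam0 : ediam (set0 : set 'rV[R]_n) = -oo.
Proof.
rewrite /ediam (_ : [set _ | _ in _] = set0) ?ereal_sup0//.
by rewrite -subset0 => z [[a b] []].
Qed.

Lemma hausdorff_content_ge0 delta A : 0 <= hausdorff_content delta A.
Proof.
apply: le_ereal_inf_tmp => _ [F _ <-].
by apply: nneseries_ge0 => k _ _; exact: hausdorff_gauge_ge0.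
Qed.

Lemma hausdorff_content0 delta : hausdorff_content delta set0 = 0.
Proof.
apply/eqP; rewrite eq_le hausdorff_content_ge0 andbT.
apply: ereal_inf_lbound; exists (fun=> set0).
  by split => // k; rewrite ediam0 leNye.
by rewrite eseries0// => k _ _; rewrite hausdorff_gauge0.
Qed.

Lemma le_hausdorff_content delta A B :
  A `<=` B -> hausdorff_content delta A <= hausdorff_content delta B.
Proof.
move=> AB; apply: ereal_inf_le_tmp => x [F [dF BF] <-].
by exists F => //; split => //; exact: subset_trans BF.
Qed.

Lemma hausdorff_content_sigma_subadditive delta :
  sigma_subadditive (hausdorff_content delta).
Proof.
move=> A.
have [[i ioo]|] := pselect (exists i, hausdorff_content delta (A i) = +oo).
  rewrite (eseries_pinfty _ _ ioo) ?leey// => k _.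
  by rewrite -ltNye (lt_le_trans _ (hausdorff_content_ge0 _ _)).
rewrite -forallNE => Aoo.
apply/lee_addgt0Pr => e e0.
rewrite (le_trans _ (epsilon_trick _ _ (ltW e0)))//; last first.
  by move=> k; exact: hausdorff_content_ge0.
pose P k (B : (set 'rV[R]_n)^nat) := hausdorff_cover delta (A k) B /\
  \sum_(j <oo) hausdorff_gauge (B j) <=
    hausdorff_content delta (A k) + (e / (2 ^ k.+1)%:R)%:E.
have [G PG] : {G : ((set 'rV[R]_n)^nat)^nat & forall k, P k (G k)}.
  apply: (@choice _ _ P) => k; rewrite /P /hausdorff_content.
  set S := (X in ereal_inf X).
  have en1 : (0 < e / (2 ^ k.+1)%:R)%R by rewrite divr_gt0// ltr0n expn_gt0.
  have fS : ereal_inf S \is a fin_num.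
    rewrite ge0_fin_numE ?ltey; last exact: hausdorff_content_ge0.
    exact/eqP/Aoo.
  have [x [B cB <-] xS] := lb_ereal_inf_adherent en1 fS.
  by exists B; split => //; exact/ltW.
have gG_ge0 x : 0 <= (hausdorff_gauge \o uncurry G) x.
  exact: hausdorff_gauge_ge0.
apply: (@le_trans _ _ (\esum_(i in setT) (hausdorff_gauge \o uncurry G) i)).
  apply: ereal_inf_lbound => /=.
  have /card_esym/ppcard_eqP[f] := card_nat2.
  exists (uncurry G \o f).
    split => [i|t [i _] /(PG i).1.2 [j _ Gijt]].
      by rewrite /= /uncurry; case: (f i) => a b; exact: (PG a).1.1.
    by exists (f^-1%FUN (i, j)) => //=; rewrite invK ?inE.
  rewrite -(esum_pred_image (hausdorff_gauge \o uncurry G) _ xpredT)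
    ?[fun=> _]set_true//.
  by rewrite image_eq.
rewrite (_ : esum _ _ =
    \sum_(i <oo) \sum_(j <oo ) hausdorff_gauge (G i j)); last first.
  pose J : nat -> set (nat * nat) := fun i => [set (i, j) | j in setT].
  rewrite (_ : setT = \bigcup_k J k); last first.
    by rewrite predeqE => -[a b]; split => // _; exists a => //; exists b.
  rewrite esum_bigcupT//; last first.
    apply/trivIsetP => i j _ _ ij.
    rewrite predeqE => -[k l] /=; split => //=; rewrite /J /=.
    by move=> [[_ _ [? _]]] [_ _ [? _]]; move/eqP: ij; subst.
  rewrite nneseries_esumT//; last first.
    by move=> k; apply: nneseries_ge0 => ? _ _; exact: hausdorff_gauge_ge0.
  apply: eq_esum => /= i _; rewrite /J esum_image; last first.
    by move=> ? ? _ _ [].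
  rewrite nneseries_esumT//.
  by move=> ?; exact: hausdorff_gauge_ge0.
apply: lee_nneseries => [k _ _|k _]; last exact: (PG k).2.
by apply: nneseries_ge0 => ? _ _; exact: hausdorff_gauge_ge0.
Qed.

Lemma hausdorff_ge0 A : 0 <= hausdorff A.
Proof.
apply: le_trans (hausdorff_content_ge0 1 A) _.
by apply: ereal_sup_ubound; exists 1%R => //=.
Qed.

Lemma hausdorff0 : hausdorff set0 = 0.
Proof.
apply/eqP; rewrite eq_le hausdorff_ge0 andbT.
by apply: ge_ereal_sup => _ [delta _ <-]; rewrite hausdorff_content0.
Qed.

Lemma le_hausdorff : {homo hausdorff : A B / A `<=` B >-> A <= B}.
Proof.
move=> A B AB; apply: ge_ereal_sup => _ [delta d0 <-].
apply: le_trans (le_hausdorff_content delta AB) _.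
by apply: ereal_sup_ubound; exists delta.
Qed.

Lemma hausdorff_sigma_subadditive : sigma_subadditive hausdorff.
Proof.
move=> A; apply: ge_ereal_sup => _ [delta d0 <-].
apply: le_trans (hausdorff_content_sigma_subadditive _ _) _.
apply: lee_nneseries => [k _ _|k _]; first exact: hausdorff_content_ge0.
by apply: ereal_sup_ubound; exists delta.
Qed.

HB.instance Definition _ := isOuterMeasure.Build R 'rV[R]_n hausdorff
  hausdorff0 hausdorff_ge0 le_hausdorff hausdorff_sigma_subadditive.

Definition hausdorff_outer : {outer_measure set 'rV[R]_n -> \bar R} :=
  hausdorff.

(* The measurable sets of this measure are the Caratheodory-measurable ones. *)
Definition hausdorff_measure :
    {measure set (caratheodory_type hausdorff_outer) -> \bar R} :=
  (hausdorff_outer : set (caratheodory_type hausdorff_outer) -> \bar R).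

End hausdorff_measure.

Section smooth_boundary.
Context {R : realType} {n : nat}.
Implicit Types (Omega U : set 'rV[R]_n) (f phi : 'rV[R]_n -> R) (x : 'rV[R]_n).

Definition gradient f x : 'rV[R]_n :=
  \row_(i < n) 'D_(delta_mx 0 i) (f : 'rV[R]_n -> R^o) x.

Fixpoint class_C (k : nat) U f : Prop :=
  match k with
  | 0 => {in U, continuous f}
  | k'.+1 => {in U, forall x, differentiable (f : 'rV[R]_n -> R^o) x} /\
             forall i : 'I_n, class_C k' U (fun x => gradient f x 0 i)
  end.

Definition smooth_on U f : Prop := forall k, class_C k U f.

(* Omega is meant to be closed; phi <= 0 on the side of Omega, so that the
   gradient of phi points outwards. *)
Definition local_defining_function Omega x U phi : Prop :=
  [/\ open U, U x, smooth_on U phi, {in U, forall y, gradient phi y != 0} &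
      Omega `&` U = [set y | phi y <= 0] `&` U].

Definition smooth_boundary Omega : Prop :=
  forall x, boundary Omega x ->
    exists U phi, local_defining_function Omega x U phi.

(* Two local defining functions at a boundary point have positively
   proportional gradients, so the choice made by get is immaterial. *)
Definition outward_normal Omega x : 'rV[R]_n :=
  get [set v | exists U phi, local_defining_function Omega x U phi /\
                 v = (enorm (gradient phi x))^-1 *: gradient phi x].

Definition convex_body Omega : Prop :=
  [/\ compact Omega, convex_set (Omega : set (convex_lmodType 'rV[R]_n)) &
      Omega° !=set0].

End smooth_boundary.

Section fractional_willmore.
Context {R : realType} {d : nat}.
Variables (cs s : R) (Omega : set 'rV[R]_d.+1).
Local Open Scope ereal_scope.

Definition fractional_mean_curvature (x : 'rV[R]_d.+1) : \bar R :=
  cs%:E * \int[hausdorff_measure d]_(y in boundary Omega)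
    (edot (x - y)%R (outward_normal Omega y)
     / enorm (x - y)%R `^ (d%:R + 1 + s))%:E.

Definition fractional_willmore (p : R) : \bar R :=
  \int[hausdorff_measure d]_(x in boundary Omega)
    (`| fractional_mean_curvature x | `^ p).

End fractional_willmore.

(* Main.v *)
Require Import Defs.
From mathcomp Require Import all_boot all_order all_algebra.
From mathcomp Require Import all_classical all_reals all_analysis.
From mathcomp Require Import measurable_realfun.
From mathcomp Require unstable.
From mathcomp Require Import ring lra.
Import Order.TTheory GRing.Theory Num.Theory.
Import numFieldNormedType.Exports.
Local Open Scope classical_set_scope.
Local Open Scope ring_scope.

(** The energy scales like (length)^(d - s p), and d - s p < 0, so it suffices
    to exhibit, for a length r intrinsic to the body, two pieces of Sigma of
    area at least K r^d such that every x in the first sees the second under a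
    kernel of size at least r^(-d-s).  Then |H| >= h1 r^(-s) on the first piece,
    hence W >= A r^(d - s p); the bound W <= Lambda forces r >= r1, and the area
    of the first piece alone is at least K r1^d.

    The length r is (nearly) the inradius.  If B(z,r) is an almost largest ball
    in Omega, then Sigma comes close to the ball at some q1; moving the ball
    slightly away from q1 must meet Sigma again, at some q2 with
    <q1 - z, q2 - z> <= 0 ([opposite_contacts]).  For y in Sigma near q2, the
    supporting half-space at y contains the ball, so n(y) almost points in the
    direction q2 - z and therefore <y - x, n(y)> >= r/2 for all x near q1,
    whereas |x - y| <= 3r ([kernel_geometry_near_contacts]).  Convexity gives
    the integrand a constant sign, so no cancellation occurs.

    Near q1 and q2 the surface has area at least K r^d: some coordinate axis e_j
    leads from q_i into the ball, convexity shows that each line parallel to e_j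
    and passing close to q_i crosses Sigma near q_i ([boundary_crosses_lines]),
    and a set whose shadow along e_j contains a d-cube of side L has Hausdorff
    measure at least a constant times L^d ([hausdorff_projection_ge]).  The
    latter reduces to countable subadditivity of d-dimensional volume for cubes,
    which is proved by slicing ([cube_cover]).

    The curvature integrals are suprema over simple functions below the
    integrand, so lower bounds need measurability of the sets of integration
    only ([le_integral_cst_subset]): the two pieces are closed, and closed sets
    are Caratheodory measurable because the Hausdorff outer measure is additive
    on sets at positive distance ([closed_caratheodory]). *)

(** * Euclidean inner product and norm *)

Section euclid.
Context {R : realType} {n : nat}.
Implicit Types (u v w : 'rV[R]_n) (a b : R).

Lemma edotC u v : edot u v = edot v u.
Proof. by apply: eq_bigr => i _; rewrite mulrC. Qed.

Lemma edotDl u v w : edot (u + v) w = edot u w + edot v w.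
Proof. by rewrite /edot -big_split; apply: eq_bigr => i _; rewrite !mxE mulrDl. Qed.

Lemma edotZl a u v : edot (a *: u) v = a * edot u v.
Proof. by rewrite /edot mulr_sumr; apply: eq_bigr => i _; rewrite !mxE mulrA. Qed.

Lemma edotDr u v w : edot u (v + w) = edot u v + edot u w.
Proof. by rewrite edotC edotDl !(edotC u). Qed.

Lemma edotZr a u v : edot u (a *: v) = a * edot u v.
Proof. by rewrite edotC edotZl edotC. Qed.

Lemma edotNl u v : edot (- u) v = - edot u v.
Proof. by rewrite -scaleN1r edotZl mulN1r. Qed.

Lemma edotNr u v : edot u (- v) = - edot u v.
Proof. by rewrite edotC edotNl edotC. Qed.

Definition edotE := (edotDl, edotDr, edotNl, edotNr, edotZl, edotZr).

Lemma edot_ge0 u : 0 <= edot u u.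
Proof. by apply: sumr_ge0 => i _; rewrite -expr2 sqr_ge0. Qed.

Lemma edot_eq0 u : edot u u = 0 -> u = 0.
Proof.
move=> /eqP; rewrite psumr_eq0; last by move=> i _; rewrite -expr2 sqr_ge0.
move=> /allP u0; apply/rowP => i; rewrite mxE; apply/eqP.
by have := u0 i (mem_index_enum _); rewrite /= mulf_eq0 orbb.
Qed.

Lemma enorm_ge0 u : 0 <= enorm u.
Proof. exact: sqrtr_ge0. Qed.

Lemma sqr_enorm u : enorm u ^+ 2 = edot u u.
Proof. by rewrite sqr_sqrtr// edot_ge0. Qed.

Lemma edot0l v : edot 0 v = 0.
Proof. by rewrite -(scale0r 0) edotZl mul0r. Qed.

Lemma edot_sqr_le u v : edot u v ^+ 2 <= edot u u * edot v v.
Proof.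
have [u0|u0] := eqVneq (edot u u) 0.
  by rewrite (edot_eq0 _ u0) !edot0l expr0n mul0r.
have up : 0 < edot u u by rewrite lt_neqAle eq_sym u0 edot_ge0.
have := edot_ge0 (edot u u *: v - edot u v *: u).
rewrite !edotE (edotC v u) => H.
rewrite -subr_ge0 -(pmulr_rge0 _ up).
by apply: le_trans H _; rewrite le_eqVlt; apply/orP; left; apply/eqP; ring.
Qed.

Lemma edot_le u v : `|edot u v| <= enorm u * enorm v.
Proof.
rewrite -(@ler_pXn2r _ 2)// ?nnegrE ?mulr_ge0 ?enorm_ge0//.
by rewrite exprMn !sqr_enorm real_normK ?num_real// edot_sqr_le.
Qed.

Lemma edot_le_enorm u v : edot u v <= enorm u * enorm v.
Proof. exact: le_trans (ler_norm _) (edot_le u v). Qed.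

Lemma enormD u v : enorm (u + v) <= enorm u + enorm v.
Proof.
rewrite -(@ler_pXn2r _ 2)// ?nnegrE ?addr_ge0 ?enorm_ge0//.
rewrite sqr_enorm !edotE (edotC v u) -!sqr_enorm.
have := edot_le_enorm u v; nra.
Qed.

Lemma enormZ a u : enorm (a *: u) = `|a| * enorm u.
Proof.
by rewrite /enorm !edotE mulrA sqrtrM -expr2 ?sqr_ge0// sqrtr_sqr.
Qed.

Lemma enormN u : enorm (- u) = enorm u.
Proof. by rewrite -scaleN1r enormZ normrN1 mul1r. Qed.

Lemma enorm_distC u v : enorm (u - v) = enorm (v - u).
Proof. by rewrite -enormN opprB. Qed.

Lemma enorm0 : enorm (0 : 'rV[R]_n) = 0.
Proof. by rewrite -(scale0r 0) enormZ normr0 mul0r. Qed.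

Lemma le_coord_enorm u i : `|u 0 i| <= enorm u.
Proof.
rewrite -(@ler_pXn2r _ 2)// ?nnegrE ?enorm_ge0// sqr_enorm.
rewrite real_normK ?num_real// /edot (bigD1 i)//= -expr2 lerDl.
by apply: sumr_ge0 => j _; rewrite -expr2 sqr_ge0.
Qed.

Lemma enorm_le_coord u b :
  0 <= b -> (forall i, `|u 0 i| <= b) -> enorm u <= n%:R * b.
Proof.
move=> b0 ub; rewrite -(@ler_pXn2r _ 2)// ?nnegrE ?mulr_ge0 ?enorm_ge0//.
rewrite sqr_enorm; apply: (@le_trans _ _ (\sum_(i < n) b ^+ 2)).
  apply: ler_sum => i _; rewrite -expr2 -(real_normK (num_real (u 0 i))).
  by rewrite ler_pXn2r ?nnegrE.
rewrite sumr_const card_ord -[leLHS]mulr_natl exprMn ler_wpM2r ?sqr_ge0//.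
by case: (n) => [|k]; rewrite ?expr0n// ler_eXnr// ler1n.
Qed.

End euclid.

(** * Euclidean balls, boundaries and convexity *)

Section topology.
Context {R : realType} {n : nat}.
Implicit Types (x y z u v w : 'rV[R]_n) (A Omega : set 'rV[R]_n) (e r : R).

Lemma nbhs_enormP x A :
  nbhs x A <-> exists2 e, 0 < e & forall y, enorm (y - x) < e -> A y.
Proof.
split=> [/nbhs_ballP[e /= e0 eA]|[e e0 eA]].
  exists e => // y yx; apply: eA; split=> // i j.
  rewrite -ball_normE /= (ord1 i) distrC.
  by apply: le_lt_trans yx; have := le_coord_enorm (y - x) j; rewrite !mxE.
apply/nbhs_ballP; exists (e / n.+1%:R) => /=; first by rewrite divr_gt0.
move=> y [_ yx]; apply: eA.
have eb : 0 <= e / n.+1%:R by rewrite divr_ge0// ltW.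
apply: (@le_lt_trans _ _ (n%:R * (e / n.+1%:R))).
  apply: enorm_le_coord => // i; have := yx 0 i.
  by rewrite -ball_normE /= distrC !mxE => /ltW.
by rewrite mulrCA gtr_pMr// ltr_pdivrMr// mul1r ltr_nat.
Qed.

Lemma closed_boundary A : closed (boundary A).
Proof.
by apply: closedI; [exact: closed_closure | exact/open_closedC/open_interior].
Qed.

Lemma boundaryE A x : closed A -> boundary A x <-> A x /\ ~ A° x.
Proof. by move=> cA; rewrite /boundary -(closure_id A).1. Qed.

(** The last parameter for which the segment is still in A is a boundary point:
    A is closed, and an interior point would allow to go further. *)
Lemma boundary_segment A x y : closed A -> A x -> ~ A y ->
  exists2 t, 0 <= t <= 1 & boundary A (x + t *: (y - x)).
Proof.
move=> cA Ax nAy; pose p t := x + t *: (y - x).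
have pB s t : enorm (p s - p t) = `|s - t| * enorm (y - x).
  by rewrite -enormZ scalerBl /p; congr enorm; rewrite opprD addrACA subrr add0r.
pose S := [set t | 0 <= t <= 1 /\ A (p t)].
have S0 : S 0 by split; rewrite ?lexx ?ler01// /p scale0r addr0.
have hS : has_sup S by split; [exists 0 | exists 1 => t [/andP[]]].
have s0 : 0 <= sup S by apply: ub_le_sup => //; exact: hS.2.
have s1 : sup S <= 1 by apply: ge_sup => [|t [/andP[]]//]; exists 0.
pose M := enorm (y - x) + 1.
have M0 : 0 < M by rewrite ltr_wpDl// enorm_ge0.
have MS k : 0 < k -> k / M * enorm (y - x) < k.
  move=> k0; rewrite mulrAC ltr_pdivrMr// ltr_pM2l//; rewrite /M; lra.
have As : A (p (sup S)).
  apply: contrapT => nA.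
  have : nbhs (p (sup S)) (~` A).
    by apply: open_nbhs_nbhs; split => //; exact: closed_openC.
  move=> /nbhs_enormP[e e0 He].
  have eM : 0 < e / M by rewrite divr_gt0.
  have [t [t01 At] tS] := sup_adherent eM hS.
  apply: (He (p t) _ At); rewrite pB; apply: le_lt_trans (MS _ e0).
  rewrite ler_wpM2r ?enorm_ge0// ler_norml.
  by have := ub_le_sup hS.2 (conj t01 At) => *; apply/andP; split; lra.
exists (sup S); first by rewrite s0.
apply/boundaryE => //; split => // /nbhs_enormP[e e0 He].
have s1' : sup S < 1.
  rewrite lt_neqAle s1 andbT; apply/eqP => s1'.
  by apply: nAy; move: As; rewrite s1' /p scale1r addrC subrK.
pose k := Num.min (e / M) (1 - sup S).
have k0 : 0 < k by rewrite lt_min divr_gt0//= subr_gt0.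
have : S (sup S + k).
  split; first by rewrite addr_ge0//= ?(ltW k0)// -lerBrDl ge_min lexx orbT.
  apply: He; rewrite pB addrAC subrr add0r gtr0_norm//.
  apply: le_lt_trans (MS _ e0).
  by rewrite ler_wpM2r ?enorm_ge0// ge_min lexx.
by move/(ub_le_sup hS.2); rewrite gerDl leNgt k0.
Qed.

Lemma convex_setE A x y t : convex_set (A : set (convex_lmodType 'rV[R]_n)) ->
  A x -> A y -> 0 <= t <= 1 -> A (x + t *: (y - x)).
Proof.
move=> cA Ax Ay /andP[t0 t1].
have := cA y x (Itv01 t0 t1); rewrite !inE => /(_ Ay Ax).
set z := (X in A X); suff -> : x + t *: (y - x) = z by [].
apply/rowP => i; rewrite /z /conv/= !mxE /= /unstable.onem; ring.
Qed.

(** The homothety of ratio 1/2 centred at x maps the ball around y into A. *)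
Lemma midpoint_interior A x y e :
  convex_set (A : set (convex_lmodType 'rV[R]_n)) -> A x -> 0 < e ->
  (forall z, enorm (z - y) < e -> A z) -> A° (2^-1 *: (x + y)).
Proof.
move=> cA Ax e0 eA; apply/nbhs_enormP; exists (e / 2); first by rewrite divr_gt0.
move=> z ze; have Az : A (y + 2 *: (z - 2^-1 *: (x + y))).
  by apply: eA; rewrite addrC addKr enormZ gtr0_norm//; lra.
have := convex_setE _ _ _ 2^-1 cA Ax Az.
have -> : x + 2^-1 *: (y + 2 *: (z - 2^-1 *: (x + y)) - x) = z.
  by apply/rowP => i; rewrite !mxE; field.
by apply; lra.
Qed.

End topology.

(** * The outward normal of a smooth convex body *)

Section normal.
Context {R : realType} {n : nat}.
Implicit Types (x y z u v w : 'rV[R]_n) (A Omega : set 'rV[R]_n) (e r : R).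

Lemma derive_gradient (f : 'rV[R]_n -> R) x v :
  differentiable (f : 'rV[R]_n -> R^o) x ->
  'D_v (f : 'rV[R]_n -> R^o) x = edot v (gradient f x).
Proof.
move=> df; rewrite deriveE// [in LHS](row_sum_delta v) linear_sum /edot.
by apply: eq_bigr => i _; rewrite mxE deriveE// linearZ.
Qed.

Lemma derive_le0 (f : 'rV[R]_n -> R) x v e : 0 < e ->
  differentiable (f : 'rV[R]_n -> R^o) x ->
  (forall t, 0 < t < e -> f (x + t *: v) <= f x) ->
  'D_v (f : 'rV[R]_n -> R^o) x <= 0.
Proof.
move=> e0 df fle.
have dv : derivable (f : 'rV[R]_n -> R^o) x v by exact: diff_derivable.
have : h^-1 *: ((f \o shift x) (h *: v) - f x) @[h --> (0:R)^'+] -->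
    ('D_v (f : 'rV[R]_n -> R^o) x : R^o).
  apply: cvg_trans dv; apply: cvg_app; apply: within_subset.
    by move=> t /=; rewrite lt_neqAle eq_sym => /andP[].
move/cvgr_to_le; apply; near=> t.
have t0 : 0 < t by near: t; exact: nbhs_right_gt.
have te : t < e by near: t; exact: nbhs_right_lt.
change (t^-1 * (f (t *: v + x) - f x) <= 0).
by rewrite pmulr_rle0 ?invr_gt0// subr_le0 addrC; apply: fle; rewrite t0.
Unshelve. all: by end_near. Qed.

Lemma local_defining_function_differentiable Omega x U phi y :
  local_defining_function Omega x U phi -> U y ->
  differentiable (phi : 'rV[R]_n -> R^o) y.
Proof. by case=> _ _ /(_ 1%N)[dphi _] _ _ Uy; apply: dphi; rewrite inE. Qed.

(** A defining function vanishes at y (otherwise y would be interior) and is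
    nonpositive near y on the segment from y to w, so its derivative at y in the
    direction w - y cannot be positive. *)
Lemma gradient_convex_le0 Omega y U phi w :
  closed Omega -> convex_set (Omega : set (convex_lmodType 'rV[R]_n)) ->
  boundary Omega y -> local_defining_function Omega y U phi ->
  Omega w -> edot (w - y) (gradient phi y) <= 0.
Proof.
move=> cO cvx /(boundaryE _ _ cO)[Oy nOy] ldf Ow.
have [oU Uy _ _ OU] := ldf.
have dphi := local_defining_function_differentiable _ _ _ _ _ ldf Uy.
have phiy : 0 <= phi y.
  rewrite leNgt; apply/negP => phiy0; apply: nOy.
  have : nbhs y (U `&` [set z | phi z < 0]).
    apply: filterI; first exact: open_nbhs_nbhs.
    have := differentiable_continuous dphi.
    by move/(_ [set t | t < 0]); apply; apply: open_nbhs_nbhs; split;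
      [exact: open_lt|exact: phiy0].
  apply: filterS => z [Uz /ltW phiz].
  by have [] : (Omega `&` U) z by rewrite OU; split => //=.
rewrite -derive_gradient//.
have [e e0 eU] := (nbhs_enormP _ _).1 (open_nbhs_nbhs (conj oU Uy)).
pose M := enorm (w - y) + 1.
have M0 : 0 < M by rewrite ltr_wpDl// enorm_ge0.
apply: (@derive_le0 _ _ _ (Num.min 1 (e / M))) => //.
  by rewrite lt_min ltr01 divr_gt0.
move=> t /andP[t0]; rewrite lt_min => /andP[t1 te].
apply: le_trans phiy; set z := (_ + _).
suff : (Omega `&` U) z by rewrite OU => -[].
split; first by apply: convex_setE => //; rewrite (ltW t0) (ltW t1).
apply: eU; rewrite /z addrAC subrr add0r enormZ gtr0_norm//.
move: te; rewrite ltr_pdivlMr//; apply: le_lt_trans.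
by rewrite ler_wpM2l// ?(ltW t0)// /M lerDl.
Qed.

Lemma convex_body_closed Omega : convex_body Omega -> closed Omega.
Proof. by case=> cO _ _; apply: compact_closed => //; exact: norm_hausdorff. Qed.

(** The hyperplane orthogonal to the normal at y supports Omega; this holds for
    every admissible defining function, hence for the chosen one. *)
Lemma outward_normal_spec Omega y : convex_body Omega -> smooth_boundary Omega ->
  boundary Omega y -> enorm (outward_normal Omega y) = 1 /\
  forall w, Omega w -> edot (w - y) (outward_normal Omega y) <= 0.
Proof.
move=> cb sb by_; have cO := convex_body_closed _ cb.
rewrite /outward_normal; set S := [set v | _].
have : S (get S).
  have [U [phi ldf]] := sb _ by_.
  by apply: getI; exists U, phi; split; [exact: ldf|reflexivity].
move=> [U [phi [ldf ->]]]; have [_ Uy _ gphi _] := ldf.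
have gp : 0 < enorm (gradient phi y).
  rewrite lt_neqAle enorm_ge0 andbT eq_sym; apply/eqP => g0.
  have /eqP := gphi y (mem_set Uy); apply; apply: edot_eq0.
  by rewrite -sqr_enorm g0 expr0n.
split; first by rewrite enormZ gtr0_norm ?invr_gt0// mulVf// gt_eqF.
move=> w Ow; rewrite edotZr pmulr_rle0 ?invr_gt0//.
case: cb => _ cvx _; exact: gradient_convex_le0 ldf Ow.
Qed.

End normal.

(** * Almost largest inscribed balls and their contact points *)

Section geometry.
Context {R : realType} {d : nat}.
Local Notation V := 'rV[R]_d.+1.
Implicit Types (x y z u v w q : V) (A Omega : set V) (e r t : R).

Definition eball z r : set V := [set y | enorm (y - z) < r].

Lemma enorm_delta (i : 'I_d.+1) : enorm (delta_mx 0 i : V) = 1.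
Proof.
rewrite /enorm /edot (bigD1 i)//= big1 ?mxE ?eqxx ?mulr1 ?addr0 ?sqrtr1//.
by move=> j ji; rewrite mxE eqxx/= (negbTE ji) mul0r.
Qed.

Lemma edot_delta u (i : 'I_d.+1) : edot u (delta_mx 0 i) = u 0 i.
Proof.
rewrite /edot (bigD1 i)//= big1 ?mxE ?eqxx ?mulr1 ?addr0//.
by move=> j ji; rewrite mxE eqxx/= (negbTE ji) mulr0.
Qed.

Lemma compact_enorm_bounded A : compact A ->
  exists2 M, 0 <= M & forall x, A x -> enorm x <= M.
Proof.
move=> /compact_bounded[M [_ HM]].
have M1 : M < `|M| + 1 by rewrite (le_lt_trans (ler_norm _))// ltrDl.
have M0 : 0 <= `|M| + 1 by rewrite addr_ge0.
exists (d.+1%:R * (`|M| + 1)); first by rewrite mulr_ge0.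
move=> x Ax; apply: enorm_le_coord => // i.
apply: le_trans (HM _ M1 _ Ax).
change (`|x 0 i| <= mx_norm x); rewrite mx_normrE.
by apply: (le_bigmax _ (fun ij : 'I_1 * 'I_d.+1 => `|x ij.1 ij.2|) (0, i)).
Qed.

Lemma eball_interior A z r y : eball z r `<=` A -> eball z r y -> A° y.
Proof.
move=> zrA zry; apply/nbhs_enormP; exists (r - enorm (y - z)).
  by rewrite subr_gt0.
move=> w wy; apply: zrA; rewrite /eball/=; have := enormD (w - y) (y - z).
by rewrite addrA subrK; lra.
Qed.

(** The radius is chosen within a factor 1 + h of the supremum of the radii of
    inscribed balls, which avoids proving that the supremum is attained. *)
Lemma near_maximal_ball Omega (h : R) : 0 < h -> compact Omega -> Omega° !=set0 ->
  exists z r, [/\ 0 < r, eball z r `<=` Omega &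
    forall z', ~ (eball z' ((1 + h) * r) `<=` Omega)].
Proof.
move=> h0 cO [z0 /nbhs_enormP[e0 e00 He0]].
have [M M0 HM] := compact_enorm_bounded _ cO.
pose S := [set r | 0 < r /\ exists z, eball z r `<=` Omega].
have Se0 : S e0 by split => //; exists z0.
have hS : has_sup S.
  split; first by exists e0.
  exists (4 * M) => r [r0 [z Hz]].
  have : Omega z by apply: Hz; rewrite /eball/= subrr enorm0.
  have : Omega (z + (r / 2) *: delta_mx 0 0).
    apply: Hz; rewrite /eball/= addrC addKr enormZ enorm_delta mulr1.
    by rewrite gtr0_norm ?divr_gt0//; lra.
  move=> /HM + /HM; rewrite -(enormN z).
  have := enormD (z + (r / 2) *: delta_mx 0 0) (- z).
  rewrite addrAC subrr add0r enormZ enorm_delta mulr1 gtr0_norm ?divr_gt0//.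
  lra.
have s0 : 0 < sup S by apply: lt_le_trans e00 _; exact: (ub_le_sup hS.2 Se0).
pose k := sup S * h / (1 + h).
have k0 : 0 < k by rewrite /k divr_gt0 ?mulr_gt0// addr_gt0.
have [r [r0 [z Hz]] kr] := sup_adherent k0 hS.
exists z, r; split => // z' Hz'.
have : S ((1 + h) * r) by split; [rewrite mulr_gt0// addr_gt0 | exists z'].
move/(ub_le_sup hS.2); apply/negP; rewrite -ltNge.
have -> : sup S = (1 + h) * (sup S - k) by rewrite /k; field; lra.
by rewrite ltr_pM2l// addr_gt0.
Qed.

Lemma boundary_near Omega z r : closed Omega -> Omega z -> ~ (eball z r `<=` Omega) ->
  exists2 q, boundary Omega q & enorm (q - z) < r.
Proof.
move=> cO Oz nO.
have [w zw nOw] : exists2 w, enorm (w - z) < r & ~ Omega w.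
  apply: contrapT => nw; apply: nO => w zw; apply: contrapT => nOw.
  by apply: nw; exists w.
have [t /andP[t0 t1] bq] := boundary_segment _ _ _ cO Oz nOw.
exists (z + t *: (w - z)) => //; rewrite addrC addKr enormZ ger0_norm//.
by apply: le_lt_trans zw; rewrite ler_piMl// enorm_ge0.
Qed.

Lemma boundary_notin_eball Omega z r q : closed Omega -> eball z r `<=` Omega ->
  boundary Omega q -> r <= enorm (q - z).
Proof.
move=> cO zrO /(boundaryE _ _ cO)[_ nOq]; rewrite leNgt; apply/negP => qz.
exact/nOq/(eball_interior _ _ _ _ zrO).
Qed.

(** Almost maximality gives q1 near the ball.  Translating the ball by
    - e (q1 - z) and dilating it by 1 + h gives q2; since q2 is outside B(z,r),
    expanding |q2 - z + e (q1 - z)|^2 < (1 + h)^2 r^2 yields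
    2 e <q1 - z, q2 - z> < ((1 + h)^2 - 1 - e^2) r^2, which is nonpositive
    when h is at most e^2 / 3. *)
Lemma opposite_contacts Omega (th : R) : convex_body Omega -> 0 < th <= 1 ->
  exists z r q1 q2, [/\ 0 < r, eball z r `<=` Omega,
    boundary Omega q1 /\ boundary Omega q2,
    enorm (q1 - z) <= (1 + th) * r /\ enorm (q2 - z) <= (1 + th) * r &
    edot (q1 - z) (q2 - z) <= 0].
Proof.
move=> cb /andP[th0 th1]; have cO := convex_body_closed _ cb.
case: cb => cptO cvx O0.
pose e := th / 3; pose h := e ^+ 2 / 3.
have e0 : 0 < e by rewrite divr_gt0.
have e1 : e <= 1 / 3 by rewrite /e; lra.
have h0 : 0 < h by rewrite divr_gt0 ?exprn_gt0.
have h1 : h <= e / 9 by rewrite /h; nra.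
have [z [r [r0 Hz Hmax]]] := near_maximal_ball _ _ h0 cptO O0.
have Oz : Omega z by apply: Hz; rewrite /eball/= subrr enorm0.
have [q1 b1 q1z] := boundary_near _ _ _ cO Oz (Hmax z).
have q1r := boundary_notin_eball _ _ _ _ cO Hz b1.
pose z' := z - e *: (q1 - z).
have Oz' : Omega z'.
  apply: Hz; rewrite /eball/= /z' addrAC subrr add0r enormN enormZ gtr0_norm//.
  by nra.
have [q2 b2 q2z] := boundary_near _ _ _ cO Oz' (Hmax z').
have q2r := boundary_notin_eball _ _ _ _ cO Hz b2.
have zz : q2 - z' = (q2 - z) + e *: (q1 - z) by rewrite /z' opprB addrCA addrC.
exists z, r, q1, q2; split => //.
  have thE : th = 3 * e by rewrite /e; lra.
  split; first by apply: le_trans (ltW q1z) _; rewrite ler_wpM2r ?(ltW r0)//; lra.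
  have -> : q2 - z = (q2 - z') - e *: (q1 - z) by rewrite zz addrK.
  apply: le_trans (enormD _ _) _; rewrite enormN enormZ gtr0_norm//.
  have : e * enorm (q1 - z) <= e * ((1 + h) * r) by rewrite ler_wpM2l// ltW.
  move=> H; apply: (@le_trans _ _ ((1 + e) * ((1 + h) * r))); first lra.
  by rewrite mulrA ler_wpM2r ?(ltW r0)// thE; nra.
have hr0 : 0 <= (1 + h) * r by rewrite mulr_ge0 ?(ltW r0)//; lra.
have := q2z; rewrite -(@ltr_pXn2r _ 2)// ?nnegrE ?enorm_ge0//.
rewrite sqr_enorm zz; move: q1r q2r.
move: (q1 - z) (q2 - z) => b a q1r q2r.
rewrite !edotE -!sqr_enorm (edotC a) => H.
have H1 : r ^+ 2 <= enorm b ^+ 2 by rewrite ler_pXn2r// ?nnegrE ?enorm_ge0 ?(ltW r0).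
have H2 : r ^+ 2 <= enorm a ^+ 2 by rewrite ler_pXn2r// ?nnegrE ?enorm_ge0 ?(ltW r0).
have h2 : (1 + h) ^+ 2 <= 1 + e ^+ 2.
  by have -> : e ^+ 2 = 3 * h; [rewrite /h; lra | nra].
have H3 : ((1 + h) * r) ^+ 2 <= (1 + e ^+ 2) * r ^+ 2.
  by rewrite exprMn ler_wpM2r// exprn_ge0// ltW.
have H4 : e ^+ 2 * r ^+ 2 <= e ^+ 2 * enorm b ^+ 2.
  by rewrite ler_wpM2l// exprn_ge0// ltW.
suff : e * edot b a <= 0 by rewrite pmulr_rle0.
lra.
Qed.

(** The line through q + v in direction u starts in the ball around q - u.  It
    has left Omega at q + v + u: this point is the reflection through q of the
    point q - v - u of the ball, so if it were in Omega, then q would be the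
    midpoint of a point of Omega and an interior point. *)
Lemma boundary_crosses_lines Omega q u e v : convex_body Omega ->
  boundary Omega q -> eball (q - u) e `<=` Omega -> enorm v < e ->
  exists2 t, -1 <= t <= 1 & boundary Omega (q + v + t *: u).
Proof.
move=> cb bq He ve; have cO := convex_body_closed _ cb; case: cb => _ cvx _.
have Oa : Omega (q + v - u).
  by apply: He; rewrite /eball/= opprB addrA subrK addrAC subrr add0r.
have Ob : ~ Omega (q + v + u).
  move=> Ob; have [_] := (boundaryE _ _ cO).1 bq; apply.
  have -> : q = 2^-1 *: ((q + v + u) + (q - v - u)).
    by apply/rowP => i; rewrite !mxE; field.
  apply: (midpoint_interior _ _ _ (e - enorm v) cvx Ob); first by rewrite subr_gt0.
  move=> y ye; apply: He; rewrite /eball/=.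
  have -> : y - (q - u) = (y - (q - v - u)) - v by apply/rowP => i;
    rewrite !mxE; ring.
  by apply: le_lt_trans (enormD _ _) _; rewrite enormN; lra.
have [t /andP[t0 t1] bt] := boundary_segment _ _ _ cO Oa Ob.
exists (2 * t - 1); first by apply/andP; split; lra.
suff -> : q + v + (2 * t - 1) *: u = q + v - u + t *: (q + v + u - (q + v - u)) by [].
by apply/rowP => i; rewrite !mxE; ring.
Qed.

Lemma large_coordinate u : exists j, edot u u <= d.+1%:R * u 0 j ^+ 2.
Proof.
apply: contrapT => /forallNP nj.
have : \sum_(j < d.+1) d.+1%:R * u 0 j ^+ 2 < \sum_(j < d.+1) edot u u.
  by apply: ltr_sum => [|j _]; [apply/hasP; exists 0|rewrite ltNge; exact/negP/nj].
rewrite -mulr_sumr sumr_const card_ord -[X in _ < X]mulr_natl ltr_pM2l ?ltr0n//.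
have -> : edot u u = \sum_(j < d.+1) u 0 j ^+ 2 by [].
by rewrite ltxx.
Qed.

(** Moving from q by - t, t = c u_j, along an axis j with u_j^2 >= |u|^2 / (d + 1),
    where u = q - z, decreases |u|^2 by (2c - c^2) u_j^2 >= c |u|^2 / (d + 1);
    the value of th is such that this relative gain of 4 th absorbs both the
    initial excess 1 + th and the radius th r of the new ball. *)
Lemma axis_ball z q r c th : 0 < c <= 1 -> 0 < r -> th = c / (4 * d.+1%:R) ->
  enorm (q - z) <= (1 + th) * r ->
  exists j t, `|t| <= 2 * c * r /\
    eball (q - t *: delta_mx 0 j) (th * r) `<=` eball z r.
Proof.
move=> /andP[c0 c1] r0 thE qz; have [u uE] : exists u, u = q - z by exists (q - z).
rewrite -uE in qz; have [j uj] := large_coordinate u.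
have n0 : (0 : R) < d.+1%:R by rewrite ltr0n.
have th0 : 0 < th by rewrite thE divr_gt0// mulr_gt0.
have th4 : c = th * (4 * d.+1%:R) by rewrite thE divfK// gt_eqF// mulr_gt0.
have thc : th <= c / 4.
  by rewrite th4 -[leLHS]mulr1 -mulrA ler_pM2l// (mulrC 4) mulfK// ler1n.
have uj' : `|u 0 j| <= (1 + th) * r by apply: le_trans qz; exact: le_coord_enorm.
exists j, (c * u 0 j); split.
  rewrite normrM gtr0_norm// (mulrC 2) -mulrA ler_wpM2l ?(ltW c0)//.
  by apply: le_trans uj' _; rewrite ler_pM2r//; lra.
move=> y; rewrite /eball/= => yq.
have -> : y - z = (y - (q - (c * u 0 j) *: delta_mx 0 j)) +
    (u - (c * u 0 j) *: delta_mx 0 j).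
  by rewrite uE; apply/rowP => i; rewrite !mxE; ring.
apply: le_lt_trans (enormD _ _) _.
suff : enorm (u - (c * u 0 j) *: delta_mx 0 j) <= (1 - th) * r by lra.
rewrite -(@ler_pXn2r _ 2)// ?nnegrE ?enorm_ge0//;
  last by rewrite mulr_ge0 ?(ltW r0)//; lra.
rewrite sqr_enorm !edotE edot_delta (edotC _ u) edot_delta -(sqr_enorm (delta_mx _ _)).
rewrite enorm_delta.
have H : c * edot u u <= c * (d.+1%:R * u 0 j ^+ 2) by rewrite ler_wpM2l// ltW.
have H1 : 4 * th * edot u u <= c * u 0 j ^+ 2.
  rewrite -(@ler_pM2r _ d.+1%:R)//; move: H; rewrite {1}th4; lra.
have H2 : edot u u <= ((1 + th) * r) ^+ 2.
  by rewrite -sqr_enorm ler_pXn2r// ?nnegrE ?enorm_ge0// (le_trans _ qz)// enorm_ge0.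
apply: (@le_trans _ _ ((1 - 4 * th) * ((1 + th) * r) ^+ 2)).
  apply: (@le_trans _ _ ((1 - 4 * th) * edot u u)); last first.
    by rewrite ler_wpM2l//; lra.
  have : 0 <= c * (1 - c) * u 0 j ^+ 2 by apply: mulr_ge0 (mulr_ge0 (ltW c0) _) (sqr_ge0 _); rewrite subr_ge0.
  lra.
rewrite !exprMn mulrA ler_wpM2r ?sqr_ge0//; nra.
Qed.

(** With u_i = q_i - z: the ball forces <u2, nu> to be almost r, while
    <u1, u2> <= 0 gives |u1 + 8 u2|^2 <= 65 (1 + th)^2 r^2.  The Cauchy-Schwarz
    inequality for <u1 + 8 u2, nu> then bounds <u1, nu> by 3r/8.  The weight 8
    and c = 1/128 leave enough room to absorb the distances from x to q1 and
    from y to q2. *)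
Lemma kernel_geometry_near_contacts z r c th q1 q2 x y nu : c = 1 / 128 -> 0 < th <= c ->
  0 < r -> enorm (q1 - z) <= (1 + th) * r -> enorm (q2 - z) <= (1 + th) * r ->
  edot (q1 - z) (q2 - z) <= 0 -> enorm (x - q1) <= 3 * c * r ->
  enorm (y - q2) <= 3 * c * r -> enorm nu = 1 -> r <= edot (y - z) nu ->
  r / 2 <= edot (y - x) nu /\ enorm (x - y) <= 3 * r.
Proof.
move=> -> /andP[th0 thc] r0 q1z q2z q12 xq yq nu1 yz.
have le1 w : edot w nu <= enorm w by have := edot_le_enorm w nu; rewrite nu1 mulr1.
have thr : (1 + th) * r <= 129 / 128 * r by rewrite ler_pM2r//; lra.
have xq' := le1 (x - q1); have yq' := le1 (y - q2).
split; last first.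
  have -> : x - y = (x - q1) + (q1 - z) - (q2 - z) - (y - q2).
    by apply/rowP => i; rewrite !mxE; ring.
  apply: le_trans (enormD _ _) _; rewrite enormN.
  have := enormD (x - q1 + (q1 - z)) (- (q2 - z)); rewrite enormN.
  have := enormD (x - q1) (q1 - z); lra.
have -> : edot (y - x) nu = edot (y - z) nu - edot (q1 - z) nu - edot (x - q1) nu.
  by rewrite !edotE; ring.
have yzE : edot (y - z) nu = edot (y - q2) nu + edot (q2 - z) nu.
  by rewrite -edotDl addrA subrK.
move: (q1 - z) (q2 - z) q1z q2z q12 yzE => u1 u2 q1z q2z q12.
set a := edot u1 nu; set b := edot u2 nu => yzE.
suff : a <= 3 / 8 * r by lra.
rewrite leNgt; apply/negP => ar.
have br : (1 - 3 * (1 / 128)) * r <= b by lra.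
have : (a + 8 * b) ^+ 2 <= 65 * ((1 + th) * r) ^+ 2.
  have -> : a + 8 * b = edot (u1 + 8 *: u2) nu by rewrite edotDl edotZl.
  apply: le_trans (edot_sqr_le _ _) _; rewrite -(sqr_enorm nu) nu1 expr1n mulr1.
  rewrite !edotE (edotC u2) -!sqr_enorm.
  have : enorm u1 ^+ 2 <= ((1 + th) * r) ^+ 2.
    by rewrite ler_pXn2r// ?nnegrE ?enorm_ge0// (le_trans _ q1z)// enorm_ge0.
  have : enorm u2 ^+ 2 <= ((1 + th) * r) ^+ 2.
    by rewrite ler_pXn2r// ?nnegrE ?enorm_ge0// (le_trans _ q1z)// enorm_ge0.
  lra.
apply/negP; rewrite -ltNge.
have H1 : ((1 + th) * r) ^+ 2 <= (129 / 128 * r) ^+ 2.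
  by apply: lerXn2r thr; rewrite nnegrE; have := mulr_gt0 th0 r0; lra.
(* 49/6 lies between sqrt 65 * 129/128 and 3/8 + 8 (1 - 3/128) *)
have H2 : 49 / 6 * r <= a + 8 * b by lra.
have H3 : (49 / 6 * r) ^+ 2 <= (a + 8 * b) ^+ 2.
  by apply: lerXn2r H2; rewrite nnegrE; lra.
have : 0 < r ^+ 2 by rewrite exprn_gt0.
by move: H1 H3; rewrite !exprMn; lra.
Qed.

End geometry.

(** * Lower bounds for integrals and volumes *)

(** The integral of a nonnegative function, measurable or not, is the supremum of
    the integrals of the simple functions below it, and c times the indicator of
    E is one of them. *)
Lemma le_integral_cst_subset (disp : measure_display) (T : measurableType disp)
    (R : realType) (mu : {measure set T -> \bar R}) (D E : set T)
    (f : T -> \bar R) (c : R) :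
  measurable E -> E `<=` D -> 0 <= c ->
  (forall x, D x -> (0 <= f x)%E) -> (forall x, E x -> (c%:E <= f x)%E) ->
  (c%:E * mu E <= \int[mu]_(x in D) f x)%E.
Proof.
move=> mE ED c0 f0 cf; rewrite ge0_integralE//.
apply: ereal_sup_ubound; exists (scale_nnsfun (indic_nnsfun R mE) c0).
  move=> x; change ((c * \1_E x)%:E <= (f \_ D) x)%E; rewrite /patch;
    case: ifPn => [/set_mem Dx|].
    have [Ex|nEx] := pselect (E x).
      by rewrite indicE mem_set// mulr1; exact: cf.
    by rewrite indicE memNset// mulr0; exact: f0.
  move=> /negP nD; rewrite indicE memNset ?mulr0//.
  by move=> Ex; apply: nD; exact/mem_set/ED.
by rewrite sintegralrM/= sintegral_indic.
Qed.

Section cube_cover.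
Context {R : realType}.

(** Countable subadditivity of volume, by induction on m: the slice at height t
    of the last coordinate is covered by the slices of those cubes whose last
    side contains t, and integrating the resulting inequality over t in [0, L]
    multiplies each term by at most l k. The selector P is what makes the
    induction hypothesis applicable to slices. *)
Lemma cube_cover m (L : R) (a : nat -> nat -> R) (l : nat -> R) (P : nat -> bool) :
  0 <= L -> (forall k, 0 <= l k) ->
  (forall v : nat -> R, (forall i, (i < m)%N -> 0 <= v i <= L) ->
    exists2 k, P k & forall i, (i < m)%N -> a k i <= v i <= a k i + l k) ->
  ((L ^+ m)%:E <= \sum_(k <oo) ((P k)%:R * l k ^+ m)%:E)%E.
Proof.
move=> L0 l0; elim: m P => [|m IH] P cov.
  have [//|k Pk _] := cov (fun=> 0).
  apply: le_trans (@nneseries_lim_ge _ _ xpredT 0%N k.+1 _) => [|i _ _].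
    by rewrite big_nat_recr//= Pk !expr0 mulr1 leeDr// sume_ge0// => i _;
      rewrite lee_fin mulr_ge0.
  by rewrite lee_fin mulr_ge0.
pose I k := `[a k m, a k m + l k]%classic.
pose f k (t : R) : \bar R := ((P k)%:R * l k ^+ m * \1_(I k) t)%:E.
have f0 k t : (0 <= f k t)%E by rewrite lee_fin !mulr_ge0// exprn_ge0.
have mI k : measurable (I k) by exact: measurable_itv.
have mf k : measurable_fun `[0, L] (f k).
  by apply/measurable_EFinP; apply: measurable_funM => //; exact: measurable_indic.
have slice t : `[0, L]%classic t -> ((L ^+ m)%:E <= \sum_(k <oo) f k t)%E.
  rewrite /= in_itv/= => tL.
  have := IH (fun k => P k && (a k m <= t <= a k m + l k)).
  have -> : (\sum_(k <oo) f k t = \sum_(k <oo)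
      ((P k && (a k m <= t <= a k m + l k))%:R * l k ^+ m)%:E)%E.
    apply: eq_eseriesr => k _; rewrite /f indicE mem_setE in_itv/=.
    by case: (P k); case: (_ && _); rewrite ?mulr1 ?mulr0 ?mul0r.
  apply=> v vL.
  have [|k Pk kv] := cov (fun i => if (i < m)%N then v i else t).
    by move=> i; case: ifPn => [im _|_ _]; [exact: vL|].
  exists k; first by rewrite Pk; have := kv m (leqnn _); rewrite ltnn.
  by move=> i im; have := kv i (leqW im); rewrite im.
pose D : set R := `[0, L]%classic.
have mD : measurable D by exact: measurable_itv.
have : ((L ^+ m)%:E * lebesgue_measure D <=
    \int[lebesgue_measure]_(t in D) (\sum_(k <oo) f k t))%E.
  apply: le_integral_cst_subset => //; first exact: exprn_ge0.
  by move=> t _; apply: nneseries_ge0 => k _ _.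
rewrite integral_nneseries//.
have -> : (lebesgue_measure D = L%:E)%E.
  rewrite lebesgue_measure_itv/= lte_fin; case: ltgtP L0 => // [_|<-] _ //.
  by rewrite sube0.
move=> H; rewrite exprSr EFinM; apply: le_trans H _.
apply: lee_nneseries => [k _ _|k _]; first exact: integral_ge0.
have c0 : 0 <= (P k)%:R * l k ^+ m by rewrite mulr_ge0// exprn_ge0.
have -> : (\int[lebesgue_measure]_(x in D) f k x =
    ((P k)%:R * l k ^+ m)%:E * lebesgue_measure (I k `&` D))%E.
  rewrite -(integral_indic (@lebesgue_measure R) mD (mI k)).
  refine (@integralZl_indic _ _ R (@lebesgue_measure R) D mD (fun=> I k) _ _ _) => //=.
    by rewrite ltNge c0.
  exact: mI.
rewrite exprSr mulrA [leRHS]EFinM lee_wpmul2l// ?lee_fin//.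
apply: (@le_trans _ _ (lebesgue_measure (I k))).
  by apply: le_measure; [apply: mem_set;
    exact: (measurableI _ _ (mI k) mD)|apply: mem_set; exact: (mI k)|].
rewrite lebesgue_measure_itv/=; case: ifP => _; last by rewrite lee_fin.
by rewrite -EFinD addrC addKr.
Qed.
End cube_cover.

(** * The Hausdorff measure of sets with a large projection *)

Lemma unit_ball_volume_gt0 (R : realType) m : 0 < unit_ball_volume R m.
Proof.
suff: 0 < unit_ball_volume R m /\ 0 < unit_ball_volume R m.+1 by case.
elim: m => [|m [IH0 IH1]]; first by split => /=.
split => //; rewrite [unit_ball_volume R m.+2]/=.
by rewrite mulr_gt0// divr_gt0// mulr_gt0// pi_gt0.
Qed.

Section hausdorff_lower.
Context {R : realType} {n : nat}.
Implicit Types (A B F : set 'rV[R]_n) (x y : 'rV[R]_n).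

Lemma le_enorm_ediam A x y : A x -> A y -> ((enorm (x - y))%:E <= ediam A)%E.
Proof. by move=> Ax Ay; apply: ereal_sup_ubound; exists (x, y). Qed.

Lemma ediam_fin A delta : A !=set0 -> (ediam A <= delta%:E)%E ->
  ediam A = (fine (ediam A))%:E.
Proof.
move=> [x Ax] Ad; rewrite fineK// fin_numE; apply/andP; split.
  by rewrite -ltNye; apply: lt_le_trans (le_enorm_ediam _ _ _ Ax Ax); rewrite ltNyr.
by rewrite -ltey; apply: le_lt_trans Ad _; rewrite ltry.
Qed.

End hausdorff_lower.

Section projection.
Context {R : realType} {d : nat}.
Implicit Types (E : set 'rV[R]_d.+1) (q : 'rV[R]_d.+1).

(** A set of diameter D projects along the axis j into a cube of side 2 D, so
    the projections of a cover of E give a cover of the d-cube by cubes, to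
    which [cube_cover] applies. *)
Lemma hausdorff_projection_ge E q (j : 'I_d.+1) (L : R) : 0 <= L ->
  (forall v : nat -> R, (forall i, (i < d)%N -> 0 <= v i <= L) ->
    exists2 y, E y & forall i : 'I_d, y 0 (lift j i) = q 0 (lift j i) + v i) ->
  ((unit_ball_volume R d / 4 ^+ d * L ^+ d)%:E <= hausdorff d E)%E.
Proof.
move=> L0 cov; apply: (@le_trans _ _ (hausdorff_content d 1 E)); last first.
  by apply: ereal_sup_ubound; exists 1 => //=.
apply: le_ereal_inf_tmp => _ [F [F1 EF] <-].
pose D k := if F k == set0 then 0 else fine (ediam (F k)).
have DE k : F k != set0 -> ediam (F k) = (D k)%:E.
  by move=> Fk; rewrite /D (negbTE Fk); apply: ediam_fin (F1 k); exact/set0P.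
have Dle k x y : F k x -> F k y -> enorm (x - y) <= D k.
  move=> Fx Fy; rewrite -lee_fin -DE; first exact: le_enorm_ediam.
  by apply/set0P; exists x.
have D0 k : 0 <= D k.
  have [Fk|/set0P[x Fx]] := eqVneq (F k) set0; first by rewrite /D Fk eqxx.
  by apply: le_trans (Dle _ _ _ Fx Fx); exact: enorm_ge0.
pose p k : 'rV[R]_d.+1 := xget 0 (F k).
pose a k i := if insub i is Some i' then
  p k 0 (lift j i') - q 0 (lift j i') - D k else 0.
have := cube_cover d L a (fun k => 2 * D k) (fun k => F k != set0) L0.
have D20 k : 0 <= 2 * D k by rewrite mulr_ge0.
move=> /(_ D20) H.
have {}H : ((L ^+ d)%:E <=
    \sum_(k <oo) ((F k != set0)%:R * (2 * D k) ^+ d)%:E)%E.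
  apply: H => v vL; have [y Ey yv] := cov v vL.
  have [k _ Fky] := EF _ Ey; exists k; first by apply/set0P; exists y.
  move=> i id; rewrite /a insubT.
  have -> : v i = y 0 (lift j (Ordinal id)) - q 0 (lift j (Ordinal id)).
    by rewrite yv addrC addKr.
  have Fkp : F k (p k) by apply: xgetI Fky.
  have := le_trans (le_coord_enorm (y - p k) (lift j (Ordinal id))) (Dle _ _ _ Fky Fkp).
  rewrite !mxE ler_norml /= => /andP[h1 h2].
  by apply/andP; split; lra.
set c := unit_ball_volume R d / 4 ^+ d.
have c0 : 0 <= c by rewrite divr_ge0 ?unit_ball_volume_ge0// exprn_ge0.
rewrite EFinM; apply: (@le_trans _ _ (c%:E *
  \sum_(k <oo) ((F k != set0)%:R * (2 * D k) ^+ d)%:E)%E).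
  by rewrite lee_wpmul2l// lee_fin.
rewrite -nneseriesZl; last by move=> k _; rewrite lee_fin mulr_ge0// exprn_ge0.
apply: lee_nneseries => [k _ _|k _].
  by rewrite -EFinM lee_fin; apply: mulr_ge0 => //; rewrite mulr_ge0// exprn_ge0.
rewrite /hausdorff_gauge; case: eqP => [_|/eqP Fk]; first by rewrite mul0r mule0.
rewrite mul1r DE// -EFin_expe -!EFinM lee_fin /c (_ : 4 = 2 * 2);
  last by rewrite -natrM.
rewrite !exprMn le_eqVlt; apply/orP; left; apply/eqP; field.
by rewrite expf_neq0.
Qed.

End projection.

(** * Closed sets are measurable for the Hausdorff measure *)

Section separated.
Context {R : realType} {n : nat}.
Variable m : nat.
Implicit Types (A B C X : set 'rV[R]_n) (x y : 'rV[R]_n).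
Local Open Scope ereal_scope.

(** A set of diameter less than the distance between A and B meets at most one
    of them, so a fine cover of the union splits into covers of A and of B. *)
Lemma hausdorff_content_separated A B (eta delta : R) : (delta < eta)%R ->
  (forall x y, A x -> B y -> (eta <= enorm (x - y))%R) ->
  hausdorff_content m delta A + hausdorff_content m delta B
    <= hausdorff_content m delta (A `|` B).
Proof.
move=> de sep; apply: le_ereal_inf_tmp => _ [F [Fd ABF] <-].
pose G (Y : set 'rV[R]_n) k := if F k `&` Y == set0 then set0 else F k.
have Gcov Y : Y `<=` A `|` B ->
    hausdorff_content m delta Y <= \sum_(k <oo) hausdorff_gauge m (G Y k).
  move=> YAB; apply: ereal_inf_lbound; exists (G Y) => //; split.
    by move=> k; rewrite /G; case: ifP => _; [rewrite ediam0 leNye|exact: Fd].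
  move=> x Yx; have [k _ Fkx] := ABF _ (YAB _ Yx); exists k => //.
  rewrite /G; case: eqP => // F0; exfalso.
  by have : (F k `&` Y) x by []; rewrite F0.
apply: le_trans (leeD (Gcov A _) (Gcov B _)) _.
- by move=> x; left.
- by move=> x; right.
have g0 Y k : 0 <= hausdorff_gauge m (G Y k) by exact: hausdorff_gauge_ge0.
rewrite -nneseriesD//; apply: lee_nneseries => [k _ _|k _]; first exact: adde_ge0.
rewrite /G; case: eqP => [_|/eqP/set0P[x [Fx Ax]]].
  by rewrite hausdorff_gauge0 add0e; case: ifP => _ //;
    rewrite ?hausdorff_gauge0 hausdorff_gauge_ge0.
case: eqP => [_|/eqP/set0P[y [Fy By]]]; first by rewrite hausdorff_gauge0 adde0.
exfalso; have := le_trans (le_enorm_ediam _ _ _ Fx Fy) (Fd k).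
by rewrite lee_fin leNgt => /negP; apply; apply: lt_le_trans de _; exact: sep.
Qed.

Lemma le_hausdorff_content_delta (d1 d2 : R) A : (d1 <= d2)%R ->
  hausdorff_content m d2 A <= hausdorff_content m d1 A.
Proof.
move=> d12; apply: ereal_inf_le_tmp => x [F [Fd AF] <-].
by exists F => //; split => // k; apply: le_trans (Fd k) _; rewrite lee_fin.
Qed.

(** The contents increase as delta decreases, so the suprema for A and B can be
    approached with a common delta smaller than eta. *)
Lemma hausdorff_separated A B (eta : R) : (0 < eta)%R ->
  (forall x y, A x -> B y -> (eta <= enorm (x - y))%R) ->
  hausdorff m A + hausdorff m B <= hausdorff m (A `|` B).
Proof.
move=> eta0 sep; set X := hausdorff m (A `|` B).
have key (d1 d2 : R) : (0 < d1)%R -> (0 < d2)%R ->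
    hausdorff_content m d1 A + hausdorff_content m d2 B <= X.
  move=> d10 d20; pose delta := Num.min (Num.min d1 d2) (eta / 2)%R.
  have delta0 : (0 < delta)%R by rewrite !lt_min d10 d20/= divr_gt0.
  have deltae : (delta < eta)%R.
    apply: (@le_lt_trans _ _ (eta / 2)%R); first by rewrite ge_min lexx orbT.
    by rewrite ltr_pdivrMr// ltr_pMr// ltr1n.
  apply: (@le_trans _ _ (hausdorff_content m delta A + hausdorff_content m delta B)).
    by apply: leeD; apply: le_hausdorff_content_delta; rewrite !ge_min lexx ?orbT.
  apply: le_trans (hausdorff_content_separated _ _ _ _ deltae sep) _.
  by apply: ereal_sup_ubound; exists delta.
have [->|Xy] := eqVneq X +oo; first by rewrite leey.
have fX Y : Y `<=` A `|` B -> hausdorff m Y \is a fin_num.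
  move=> YAB; rewrite ge0_fin_numE ?hausdorff_ge0//.
  by apply: le_lt_trans (le_hausdorff m YAB) _; rewrite ltey.
have fB : hausdorff m B \is a fin_num by apply: fX => x; right.
rewrite -leeBrDr//; apply: ge_ereal_sup => _ [d1 d10 <-].
have fA1 : hausdorff_content m d1 A \is a fin_num.
  rewrite ge0_fin_numE ?hausdorff_content_ge0//.
  apply: le_lt_trans (_ : _ <= hausdorff m A) _;
    first by apply: ereal_sup_ubound; exists d1.
  by rewrite -ge0_fin_numE ?hausdorff_ge0//; apply: fX => x; left.
rewrite leeBrDr// addeC -leeBrDr//; apply: ge_ereal_sup => _ [d2 d20 <-].
by rewrite leeBrDr// addeC; exact: key.
Qed.

End separated.

Section caratheodory.
Context {R : realType} {n : nat}.
Variable m : nat.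
Implicit Types (A B C X : set 'rV[R]_n) (x y : 'rV[R]_n).

Let far C (k : nat) : set 'rV[R]_n :=
  [set x | forall y, C y -> k.+1%:R^-1 <= enorm (x - y)].

(** The shells split the part of X off C according to the distance to C; shells
    whose indices differ by at least two are at positive distance. *)
Let shell X C k := X `&` (far C k.+1 `\` far C k).

Let invn_le (i j : nat) : (i <= j)%N -> (j.+1%:R^-1 : R) <= i.+1%:R^-1.
Proof. by move=> ij; rewrite lef_pV2 ?posrE ?ltr0n// ler_nat. Qed.

Let far_mono C i j : (i <= j)%N -> far C i `<=` far C j.
Proof. by move=> ij x Hx y Cy; apply: le_trans (Hx y Cy); exact: invn_le. Qed.

Let far_sep C (i j : nat) x y : far C i x -> ~ far C j y ->
  i.+1%:R^-1 - j.+1%:R^-1 <= enorm (x - y).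
Proof.
move=> fx /existsNP[c /not_implyP[Cc /negP]]; rewrite -ltNge => yc.
have := fx c Cc; have := enormD (x - y) (y - c); rewrite addrA subrK.
by move: yc; move: (i.+1%:R^-1) (j.+1%:R^-1) => ? ?; lra.
Qed.

(** The parameter b selects the parity: shells of equal parity are pairwise at
    positive distance, so their measures add up. *)
Let shell_sum X C (b N : nat) :
  (\sum_(0 <= i < N.+1) hausdorff m (shell X C (i.*2 + b)) <=
   hausdorff m (X `&` far C (N.*2 + b).+1))%E.
Proof.
elim: N => [|N IH].
  by rewrite big_nat1; apply: le_hausdorff => x [Xx []].
rewrite big_nat_recr//=; apply: le_trans (leeD IH (lexx _)) _.
set k := (N.*2 + b).+1.
have kE : (N.+1.*2 + b)%N = k.+1 by rewrite doubleS.
rewrite kE; apply: (@le_trans _ _ (hausdorff m (X `&` far C k `|` shell X C k.+1))).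
  apply: (@hausdorff_separated _ _ _ _ _ (k.+1%:R^-1 - k.+2%:R^-1)).
    by rewrite subr_gt0 ltf_pV2 ?posrE ?ltr0n// ltr_nat.
  by move=> x y [_ fx] [_ [_ fy]]; exact: (@far_sep C _ _ x y fx fy).
apply: le_hausdorff => x [[Xx fx]|[Xx [fx _]]]; split => //.
by apply: far_mono fx; rewrite leqW.
Qed.

Let shell_series X C b :
  (\sum_(k <oo) hausdorff m (shell X C (k.*2 + b)) <= hausdorff m X)%E.
Proof.
have h0 k : (0 <= hausdorff m (shell X C (k.*2 + b)))%E by exact: hausdorff_ge0.
apply: lime_le; first by apply: is_cvg_nneseries => k _ _.
apply: nearW => -[|N]; first by rewrite big_nil hausdorff_ge0.
by apply: le_trans (shell_sum _ _ _ _) _; apply: le_hausdorff => x [].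
Qed.

Let shell_finite X C : (hausdorff m X < +oo)%E ->
  (\sum_(k <oo) hausdorff m (shell X C k) < +oo)%E.
Proof.
move=> Xoo; apply: (@le_lt_trans _ _ (hausdorff m X + hausdorff m X)%E);
  last exact: lte_add_pinfty.
apply: lime_le; first by apply: is_cvg_nneseries => k _ _; exact: hausdorff_ge0.
apply: nearW => N.
apply: (@le_trans _ _ (\sum_(0 <= k < N.*2) hausdorff m (shell X C k))%E).
  rewrite -addnn [leRHS](@big_cat_nat _ _ _ N)//= ?leq_addr//.
  by rewrite leeDl// sume_ge0// => k _; exact: hausdorff_ge0.
have -> : (\sum_(0 <= k < N.*2) hausdorff m (shell X C k) =
   \sum_(0 <= k < N) hausdorff m (shell X C (k.*2 + 0)) +
   \sum_(0 <= k < N) hausdorff m (shell X C (k.*2 + 1)))%E.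
  rewrite -big_split/=; elim: N => [|N IH]; first by rewrite !big_nil.
  by rewrite doubleS !big_nat_recr//= IH addn0 addn1 addeA.
by apply: leeD; apply: le_trans (shell_series X C _);
  apply: (@nneseries_lim_ge _ _ xpredT) => k _ _; exact: hausdorff_ge0.
Qed.

(** Every point off the closed set C lies in far C k for some k; the least such
    k locates it in far C N or in one of the shells from N on. *)
Let shell_cover X C N : closed C ->
  X `&` ~` C `<=` (X `&` far C N) `|` \bigcup_(k in ~` `I_N) shell X C k.
Proof.
move=> cC x [Xx nCx].
have : nbhs x (~` C) by apply: open_nbhs_nbhs; split => //; exact: closed_openC.
move=> /nbhs_enormP[e e0 He].
have ex : exists k, `[< far C k x >].
  exists (Num.truncn e^-1); apply/asboolP => y Cy.
  rewrite leNgt; apply/negP => xy; apply: (He y) => //; rewrite enorm_distC.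
  apply: lt_trans xy _.
  by rewrite -[ltRHS]invrK ltf_pV2 ?posrE ?invr_gt0 ?ltr0n// truncnS_gt.
have [k /asboolP fk kmin] := ex_minnP ex.
have [kN|Nk] := leqP k N; first by left; split => //; exact: far_mono fk.
right; case: k fk kmin Nk => // k fk kmin Nk.
exists k; first by rewrite /= ltnNge; apply/negP/negPn.
split => //; split => // fk'.
by have := kmin k (asboolT fk'); rewrite ltnn.
Qed.

(** The sets X `&` C and X `&` far C N are at positive distance, hence additive,
    and what far C N misses of X off C is controlled by the tail of the series
    of the measures of the shells, which converges when X has finite measure. *)
Lemma closed_caratheodory C : closed C ->
  (@hausdorff_outer R n m).-caratheodory C.
Proof.
move=> cC; apply: le_caratheodory_measurable => X.
change (hausdorff m (X `&` C) + hausdorff m (X `&` ~` C) <= hausdorff m X)%E.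
have [->|Xoo] := eqVneq (hausdorff m X) +oo%E; first by rewrite leey.
have /shell_finite Sfin : (hausdorff m X < +oo)%E by rewrite ltey.
have h0 k : (0 <= hausdorff m (shell X C k))%E by exact: hausdorff_ge0.
have tail := nneseries_tail_cvg (Sfin C) (fun k _ => h0 k).
have bnd N : (hausdorff m (X `&` C) + hausdorff m (X `&` ~` C) <=
    hausdorff m X + \sum_(N <= k <oo) hausdorff m (shell X C k))%E.
  apply: (@le_trans _ _ (hausdorff m (X `&` C) + (hausdorff m (X `&` far C N) +
      \sum_(N <= k <oo) hausdorff m (shell X C k)))%E).
    rewrite leeD2l//; apply: le_trans (le_hausdorff m (shell_cover X C N cC)) _.
    apply: le_trans (outer_measureU2 (@hausdorff_outer R n m) _ _) _.
    rewrite leeD2l//.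
    exact: (outer_measure_sigma_subadditive_tail (@hausdorff_outer R n m)).
  rewrite addeA leeD2r// addeC.
  apply: (@le_trans _ _ (hausdorff m ((X `&` far C N) `|` (X `&` C)))).
    apply: (@hausdorff_separated _ _ _ _ _ N.+1%:R^-1) => [|x y [_ fx] [_ Cy]].
      by rewrite invr_gt0.
    exact: fx.
  by apply: le_hausdorff => x [[]|[]].
have : (hausdorff m X + \sum_(N <= k <oo) hausdorff m (shell X C k))%E @[N --> \oo]
    --> (hausdorff m X + 0)%E.
  by apply: cvgeD tail; [rewrite fin_num_adde_defl|exact: cvg_cst].
rewrite adde0 => /cvge_to_ge; apply; exact: nearW.
Qed.

End caratheodory.

(** * Area of boundary patches, curvature and energy *)

Section patch.
Context {R : realType} {d : nat}.
Local Notation V := 'rV[R]_d.+1.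
Implicit Types (x y z q nu : V) (Omega : set V) (r : R).

Definition boundary_patch Omega q r : set V :=
  boundary Omega `&` [set x | enorm (x - q) <= r].

Lemma closed_boundary_patch Omega q r : closed (boundary_patch Omega q r).
Proof.
apply: closedI; first exact: closed_boundary.
rewrite -[X in closed X]setCK; apply: open_closedC.
rewrite openE => x /= /negP; rewrite -ltNge => qx.
apply/nbhs_enormP; exists (enorm (x - q) - r); first by rewrite subr_gt0.
move=> y yx /=; apply/negP; rewrite -ltNge.
by have := enormD (x - y) (y - q); rewrite addrA subrK (enorm_distC x y); lra.
Qed.

Lemma boundary_patch_measurable Omega q r :
  measurable (boundary_patch Omega q r :
    set (caratheodory_type (@hausdorff_outer R d.+1 d))).
Proof. exact: closed_caratheodory (closed_boundary_patch _ _ _). Qed.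

Lemma boundary_patch_area Omega (c th : R) z q r : 0 < c <= 1 ->
  th = c / (4 * d.+1%:R) -> convex_body Omega -> 0 < r ->
  eball z r `<=` Omega -> boundary Omega q -> enorm (q - z) <= (1 + th) * r ->
  ((unit_ball_volume R d / 4 ^+ d * (th / (2 * d.+1%:R)) ^+ d * r ^+ d)%:E
     <= hausdorff d (boundary_patch Omega q (3 * c * r)))%E.
Proof.
move=> c01 thE cb r0 zrO bq qz.
have [j [t [tr jt]]] := axis_ball _ _ _ _ _ c01 r0 thE qz.
have /andP[c0 c1] := c01.
have n0 : (0 : R) < d.+1%:R by rewrite ltr0n.
have th0 : 0 < th by rewrite thE divr_gt0// mulr_gt0.
have thc : th <= c.
  rewrite thE ler_pdivrMr ?mulr_gt0// ler_peMr ?(ltW c0)//.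
  by rewrite -natrM ler1n.
rewrite -mulrA -exprMn.
set L := th / (2 * d.+1%:R) * r.
have L0 : 0 <= L by rewrite /L mulr_ge0 ?(ltW r0)// divr_ge0 ?(ltW th0)// mulr_ge0.
apply: (hausdorff_projection_ge _ q j L L0) => v vL.
(* the point v of the cube, lifted to the hyperplane orthogonal to e_j *)
pose w : V := \row_i (if unlift j i is Some i' then v i' else 0).
have wr : enorm w <= d.+1%:R * L.
  apply: enorm_le_coord => // i; rewrite mxE; case: unliftP => [i' _|_];
    last by rewrite normr0.
  by have /andP[v0 vi] := vL i' (ltn_ord i'); rewrite ger0_norm.
have LE : d.+1%:R * L = th * r / 2 by rewrite /L; field; rewrite gt_eqF.
have thr0 : 0 < th * r by rewrite mulr_gt0.
have wth : enorm w < th * r by lra.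
have [s /andP[s0 s1] bs] := boundary_crosses_lines _ _ _ _ _ cb bq (subset_trans jt zrO) wth.
exists (q + w + s *: (t *: delta_mx 0 j)).
  split => //=; rewrite addrAC (addrAC q) subrr add0r;
    apply: le_trans (enormD _ _) _.
  rewrite !enormZ enorm_delta mulr1.
  have : `|s| * `|t| <= `|t| by rewrite ler_piMl// ler_norml s0 s1.
  have : th * r <= c * r by rewrite ler_pM2r.
  lra.
move=> i; rewrite !mxE liftK eqxx/= eq_sym (negbTE (neq_lift _ _)) !mulr0 addr0.
by [].
Qed.

(** Since x is in Omega, <x - y, n(y)> <= 0 for all y in the boundary: the
    integral has no cancellation and is bounded below by its part over E. *)
Lemma curvature_ge (cs s m0 : R) Omega (E : set V) x : 0 <= cs -> 0 <= m0 ->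
  convex_body Omega -> smooth_boundary Omega -> boundary Omega x ->
  measurable (E : set (caratheodory_type (@hausdorff_outer R d.+1 d))) ->
  E `<=` boundary Omega ->
  (forall y, E y -> m0 <= edot (y - x) (outward_normal Omega y)
                          / enorm (x - y) `^ (d%:R + 1 + s)) ->
  (cs%:E * (m0%:E * hausdorff d E)
     <= `| fractional_mean_curvature cs s Omega x |)%E.
Proof.
move=> cs0 m00 cb sb bx mE EO Hm; rewrite /fractional_mean_curvature.
set f := fun y => _.
pose g y := (edot (y - x) (outward_normal Omega y)
  / enorm (x - y) `^ (d%:R + 1 + s))%:E.
have -> : f = (fun y => - g y)%E.
  by apply/funext => y; rewrite /f /g -EFinN -mulNr -edotNl opprB.
have Ox : Omega x by have [] := (boundaryE _ _ (convex_body_closed _ cb)).1 bx.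
have g0 y : boundary Omega y -> (0 <= g y)%E.
  move=> by_; rewrite lee_fin divr_ge0 ?powR_ge0//.
  have [_ /(_ _ Ox)] := outward_normal_spec _ _ cb sb by_.
  by rewrite -opprB edotNl oppr_le0.
rewrite integral_ge0N// abseM abseN !gee0_abs ?lee_fin ?integral_ge0//.
rewrite lee_wpmul2l ?lee_fin//.
exact: (@le_integral_cst_subset _ _ _ (@hausdorff_measure R d.+1 d)).
Qed.

Lemma willmore_ge (cs s p h : R) Omega (E : set V) : 0 <= p -> 0 <= h ->
  measurable (E : set (caratheodory_type (@hausdorff_outer R d.+1 d))) ->
  E `<=` boundary Omega ->
  (forall x, E x -> (h%:E <= `| fractional_mean_curvature cs s Omega x |)%E) ->
  ((h `^ p)%:E * hausdorff d E <= fractional_willmore cs s Omega p)%E.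
Proof.
move=> p0 h0 mE EO Hh; rewrite /fractional_willmore.
apply: (@le_integral_cst_subset _ _ _ (@hausdorff_measure R d.+1 d)) => //.
- exact: powR_ge0.
- by move=> x _; exact: poweR_ge0.
move=> x Ex; rewrite -poweR_EFin; apply: gt0_ler_poweR => //.
- by rewrite in_itv/= lee_fin h0 leey.
- by rewrite in_itv/= abse_ge0 leey.
- exact: Hh.
Qed.

End patch.

Lemma kernel_lower_bound (R : realType) (d : nat) (s r : R) (x y nu : 'rV[R]_d.+1) :
  0 < s -> 0 < r -> r / 2 <= edot (y - x) nu -> enorm (x - y) <= 3 * r ->
  (2 * 3 `^ (d%:R + 1 + s))^-1 * r `^ (- (d%:R + s)) <=
    edot (y - x) nu / enorm (x - y) `^ (d%:R + 1 + s).
Proof.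
move=> s0 r0 yx xy; set a := d%:R + 1 + s.
have a0 : 0 < a by rewrite ltr_pwDr// ltr_wpDl.
have xy0 : 0 < enorm (x - y).
  rewrite lt_neqAle enorm_ge0 andbT eq_sym; apply/eqP => e0.
  have := edot_le_enorm (y - x) nu; rewrite enorm_distC e0 mul0r; lra.
apply: (@le_trans _ _ ((r / 2) / (3 * r) `^ a)).
  rewrite powRM ?(ltW r0)//.
  have -> : - (d%:R + s) = 1 - a by rewrite /a; ring.
  have -> : r `^ (1 - a) = r / r `^ a.
    by rewrite powRB ?(gt_eqF r0) ?implybT// powRr1// ltW.
  have ra : 0 < r `^ a by exact: powR_gt0.
  have ta : 0 < (3 : R) `^ a by exact: powR_gt0.
  by rewrite le_eqVlt; apply/orP; left; apply/eqP; field; rewrite !gt_eqF.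
apply: ler_pM; rewrite ?invr_ge0 ?powR_ge0//; first by rewrite divr_ge0// ltW.
rewrite lef_pV2 ?posrE ?powR_gt0//; last by rewrite mulr_gt0.
by apply: ge0_ler_powR; rewrite ?nnegrE ?enorm_ge0 ?(ltW a0)// mulr_ge0 ?(ltW r0).
Qed.

(** The points z + rho nu with rho < r are in the ball; let rho tend to r. *)
Lemma support_ball (R : realType) (d : nat) (y z nu : 'rV[R]_d.+1) (r : R) :
  enorm nu = 1 -> (forall w, eball z r w -> edot (w - y) nu <= 0) ->
  0 < r -> r <= edot (y - z) nu.
Proof.
move=> nu1 H r0; rewrite leNgt; apply/negP => tr.
set t := edot (y - z) nu in tr.
pose rho := (Num.max t 0 + r) / 2.
have [t_le z_le] : t <= Num.max t 0 /\ 0 <= Num.max t 0.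
  by rewrite !le_max !lexx orbT.
have mr : Num.max t 0 < r by rewrite gt_max tr r0.
have : edot (z + rho *: nu - y) nu <= 0.
  apply: H; rewrite /eball/= addrC addKr enormZ nu1 mulr1 ger0_norm /rho; lra.
have -> : z + rho *: nu - y = rho *: nu - (y - z) by rewrite opprB addrA (addrC z).
rewrite edotDl edotNl edotZl -sqr_enorm nu1 expr1n mulr1 -/t /rho; lra.
Qed.

(** * From the energy bound to the area bound *)

Lemma radius_ge (R : realType) (e A Lambda r : R) : 0 < e -> 0 < A -> 0 < Lambda ->
  0 < r -> A * r `^ (- e) <= Lambda -> (A / Lambda) `^ e^-1 <= r.
Proof.
move=> e0 A0 L0 r0; rewrite powRN ler_pdivrMr ?powR_gt0// => H.
have : A / Lambda <= r `^ e by rewrite ler_pdivrMr// mulrC.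
have AL : 0 <= A / Lambda by rewrite divr_ge0// ltW.
move=> /(ge0_ler_powR (_ : 0 <= e^-1)) => /(_ _ _ _)/le_trans; apply.
- by rewrite invr_ge0 ltW.
- by rewrite nnegrE.
- by rewrite nnegrE powR_ge0.
by rewrite -powRrM mulfV ?gt_eqF// powRr1// ltW.
Qed.

Theorem corollary1p4 (R : realType) (d : nat) (s cs p Lambda : R)
    (hd : (1 <= d)%N) (hs0 : 0 < s) (hs1 : s < 1) (hcs : 0 < cs)
    (hp : d%:R / s < p) (hLambda : 0 < Lambda) :
  exists2 c : R, 0 < c &
    forall Omega : set 'rV[R]_d.+1,
      convex_body Omega -> smooth_boundary Omega ->
      (fractional_willmore cs s Omega p <= Lambda%:E)%E ->
      (c%:E <= hausdorff_measure d (boundary Omega))%E.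
Proof.
(* the constants of axis_ball and kernel_geometry_near_contacts *)
pose c0 : R := 1 / 128.
pose th : R := c0 / (4 * d.+1%:R).
have n0 : (0 : R) < d.+1%:R by rewrite ltr0n.
have c00 : 0 < c0 <= 1 by rewrite /c0; apply/andP; split; lra.
have th0 : 0 < th by rewrite divr_gt0 ?mulr_gt0// /c0; lra.
have thc : th <= c0.
  rewrite /th ler_pdivrMr ?mulr_gt0// ler_peMr//; first by case/andP: c00 => /ltW.
  by rewrite -natrM ler1n.
have th1 : 0 < th <= 1 by rewrite th0; apply: le_trans thc _; rewrite /c0; lra.
pose K : R := unit_ball_volume R d / 4 ^+ d * (th / (2 * d.+1%:R)) ^+ d.
have K0 : 0 < K.
  by rewrite mulr_gt0 ?exprn_gt0 ?divr_gt0 ?mulr_gt0 ?exprn_gt0 ?unit_ball_volume_gt0.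
have dp : d%:R < s * p by move: hp; rewrite ltr_pdivrMr// mulrC.
have p0 : 0 < p by apply: le_lt_trans hp; rewrite divr_ge0// ltW.
pose h1 : R := cs * (2 * 3 `^ (d%:R + 1 + s))^-1 * K.
have h10 : 0 < h1.
  by apply: mulr_gt0 => //; rewrite mulr_gt0// invr_gt0 mulr_gt0// powR_gt0.
pose A := h1 `^ p * K.
have A0 : 0 < A by rewrite mulr_gt0// powR_gt0.
pose r1 := (A / Lambda) `^ (s * p - d%:R)^-1.
have r10 : 0 < r1 by rewrite powR_gt0// divr_gt0.
exists (K * r1 ^+ d) => [|Omega cb sb HW]; first by rewrite mulr_gt0// exprn_gt0.
have [z [r [q1 [q2 [r0 zrO [b1 b2] [q1z q2z] q12]]]]] := opposite_contacts _ _ cb th1.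
pose E1 := boundary_patch Omega q1 (3 * c0 * r).
pose E2 := boundary_patch Omega q2 (3 * c0 * r).
have area q : boundary Omega q -> enorm (q - z) <= (1 + th) * r ->
    ((K * r ^+ d)%:E <= hausdorff d (boundary_patch Omega q (3 * c0 * r)))%E.
  by move=> bq qz; exact: (boundary_patch_area _ _ _ _ _ _ c00 erefl cb r0 zrO bq qz).
have E1O : E1 `<=` boundary Omega by move=> x [].
have E2O : E2 `<=` boundary Omega by move=> x [].
pose m0 := (2 * 3 `^ (d%:R + 1 + s))^-1 * r `^ (- (d%:R + s)).
have m00 : 0 <= m0 by rewrite mulr_ge0 ?powR_ge0// invr_ge0 mulr_ge0// powR_ge0.
have h1r : cs * (m0 * (K * r ^+ d)) = h1 * r `^ (- s).
  rewrite /m0 /h1 -powR_mulrn ?(ltW r0)//.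
  have -> : r `^ (- s) = r `^ (- (d%:R + s)) * r `^ d%:R.
    rewrite -powRD; first by congr (_ `^ _); ring.
    by rewrite (gt_eqF r0) implybT.
  ring.
have curv x : E1 x ->
    ((h1 * r `^ (- s))%:E <= `| fractional_mean_curvature cs s Omega x |)%E.
  move=> [bx /= xq1]; rewrite -h1r.
  apply: le_trans (curvature_ge cs s m0 Omega E2 x (ltW hcs) m00 cb sb bx _ E2O _).
  - rewrite 2!EFinM lee_wpmul2l ?lee_fin ?(ltW hcs)// lee_wpmul2l ?lee_fin//.
    exact: area.
  - exact: boundary_patch_measurable.
  move=> y [by_ /= yq2].
  have [nu1 nule] := outward_normal_spec _ _ cb sb by_.
  have yz : r <= edot (y - z) (outward_normal Omega y).
    by apply: (support_ball _ _ _ _ _ _ nu1 _ r0) => w zw; exact/nule/zrO.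
  have [H1 H2] := kernel_geometry_near_contacts _ _ _ _ _ _ _ _ _ (erefl c0)
    (introT andP (conj th0 thc)) r0 q1z q2z q12 xq1 yq2 nu1 yz.
  exact: kernel_lower_bound.
have W := le_trans (willmore_ge cs s p (h1 * r `^ (- s)) Omega E1 (ltW p0) _
  (boundary_patch_measurable _ _ _) E1O curv) HW.
have {}W := W (mulr_ge0 (ltW h10) (powR_ge0 _ _)).
have rr1 : r1 <= r.
  apply: radius_ge => //; first by rewrite subr_gt0.
  rewrite -lee_fin; apply: le_trans (W); rewrite /A.
  rewrite powRM ?powR_ge0 ?(ltW h10)// -powRrM.
  have -> : - (s * p - d%:R) = - s * p + d%:R by ring.
  rewrite powRD; last by rewrite (gt_eqF r0) ?implybT.
  rewrite powR_mulrn ?(ltW r0)// [leLHS](_ : _ =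
    (h1 `^ p * r `^ (- s * p))%:E * (K * r ^+ d)%:E)%E; last by rewrite -EFinM;
      congr EFin; ring.
  rewrite lee_wpmul2l ?lee_fin ?mulr_ge0 ?powR_ge0//; exact: area.
apply: le_trans (le_hausdorff d E1O); apply: le_trans (area _ b1 q1z).
by rewrite lee_fin ler_pM2l// lerXn2r// ?nnegrE ltW.
Qed.
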